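(* Let $m\ge 1$ and let $L$ be a complex Leibniz algebra such that the quotient $L/I$ is isomorphic to the Lie algebra $\mathfrak{D}_m(\mathbb{C})$, where $I$ is the ideal of $L$ spanned by the squares $[x,x]$, $x\in L$, and such that, as an $L/I\cong\mathfrak{D}_m(\mathbb{C})$-module, $I$ is the $(m+2)$-dimensional right $\mathfrak{D}_m(\mathbb{C})$-module $V$ described in the context. Then there exists a basis $$\{J,P_1^+,\dots,P_m^+,Q_1^-,\dots,Q_m^-,T,X_1,X_2,\dots,X_{m+2}\}$$ of $L$, where $X_1,\dots,X_{m+2}$ is a basis of $I$ on which the action of $\mathfrak{D}_m(\mathbb{C})$ is given by the formulas for $V$, and where the images of $J,P_k^+,Q_k^-,T$ in $L/I$ form a basis satisfying the defining relations of $\mathfrak{D}_m(\mathbb{C})$, such that $$[\mathfrak{D}_m(\mathbb{C}),\mathfrak{D}_m(\mathbb{C})]\subseteq \mathfrak{D}_m(\mathbb{C}),$$ where here $\mathfrak{D}_m(\mathbb{C})$ denotes the linear span in $L$ of $J,P_1^+,\dots,P_m^+,Q_1^-,\dots,Q_m^-,T$.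
   Context: A Leibniz algebra is a vector space $L$ with a bilinear product $[-,-]$ satisfying $[x,[y,z]]=[[x,y],z]-[[x,z],y]$ for all $x,y,z\in L$. The subspace $I$ spanned by all squares $[x,x]$ is an ideal with $[L,I]=0$, the quotient $L/I$ is a Lie algebra (the Lie algebra corresponding to $L$), and $I$ is a right $L/I$-module via $(v,\overline{x})\mapsto [v,x]$ for $v\in I$, $x\in L$. $\mathfrak{D}_m(\mathbb{C})$ is the $(2m+2)$-dimensional complex general Diamond Lie algebra with basis $\{J,P_1^+,\dots,P_m^+,Q_1^-,\dots,Q_m^-,T\}$ and nonzero brackets, up to antisymmetry, $$[J,P_k^{+}]=iP_k^{+},\qquad [J,Q_k^{-}]=-iQ_k^{-},\qquad [P_k^{+},Q_k^{-}]=2iT,\qquad 1\le k\le m.$$ $V$ is the right $\mathfrak{D}_m(\mathbb{C})$-module with basis $X_1,\dots,X_{m+2}$ and action $$(X_1,J)=\tfrac{im}{m+2}X_1,\qquad (X_k,J)=-\tfrac{2i}{m+2}X_k\ (2\le k\le m+1),\qquad (X_{m+2},J)=\tfrac{im}{m+2}X_{m+2},$$ $$(X_1,P_k^+)=X_{m+2-k}\ (1\le k\le m),\qquad (X_{m+2-k},Q_k^-)=X_{m+2}\ (1\le k\le m),\qquad (X_1,T)=-\tfrac{i}{2}X_{m+2},$$ all remaining products in the action being zero. *)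

(* Defs.v *)
From HB Require Import structures.
From mathcomp Require Import all_boot all_order all_algebra.
From mathcomp Require Import boolp classical_sets reals complex.

Set Implicit Arguments.
Unset Strict Implicit.
Unset Printing Implicit Defensive.

Import GRing.Theory Num.Theory.

Local Open Scope ring_scope.
Local Open Scope quotient_scope.

Section LinearAlgebra.
Variables (K : fieldType) (M : lmodType K).

Definition lspan (A : set M) : set M :=
  [set x | exists n (c : 'I_n -> K) (a : 'I_n -> M),
     (forall i, A (a i)) /\ x = \sum_i c i *: a i]%classic.

Definition is_basis (T : finType) (b : T -> M) : Prop :=
  (forall c : T -> K, \sum_i c i *: b i = 0 -> forall i, c i = 0) /\
  (forall x, exists c : T -> K, x = \sum_i c i *: b i).

Lemma lspan_mem (A : set M) x : A x -> lspan A x.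
Proof.
move=> Ax; exists 1, (fun=> 1), (fun=> x); split=> //.
by rewrite big_ord1 scale1r.
Qed.

Lemma lspan0 (A : set M) : lspan A 0.
Proof. by exists 0, (fun=> 0), (fun=> 0); split=> [[]//|]; rewrite big_ord0. Qed.

Lemma lspanZD (A : set M) k x y : lspan A x -> lspan A y -> lspan A (k *: x + y).
Proof.
move=> [n [c [a [Aa ->]]]] [p [d [b [Ab ->]]]].
exists (n + p)%N.
exists (fun i => match split i with inl j => k * c j | inr j => d j end).
exists (fun i => match split i with inl j => a j | inr j => b j end).
split=> [i|]; first by case: (split i).
rewrite big_split_ord scaler_sumr; congr (_ + _); apply: eq_bigr => i _.
  by rewrite (unsplitK (inl i)) scalerA.
by rewrite (unsplitK (inr i)).
Qed.

End LinearAlgebra.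

HB.mixin Record isLeibniz (K : fieldType) L of GRing.Lmodule K L := {
  lbr : L -> L -> L;
  lbr_linear_l : forall y, linear (lbr^~ y);
  lbr_linear_r : forall x, linear (lbr x);
  lbr_leibniz : forall x y z,
    lbr x (lbr y z) = lbr (lbr x y) z - lbr (lbr x z) y
}.

#[short(type="leibnizType")]
HB.structure Definition Leibniz (K : fieldType) :=
  {L of GRing.Lmodule K L & isLeibniz K L}.

Notation "[l x , y ]" := (lbr x y) (at level 0, x, y at level 200,
  format "[l  x ,  y ]") : ring_scope.

Section LeibnizKernel.
Variables (K : fieldType) (L : leibnizType K).
Implicit Types x y z : L.

HB.instance Definition _ x := GRing.isLinear.Build K L L *:%R (lbr x)
  (lbr_linear_r x).

Lemma lbrDl x y z : [l x + y, z] = [l x, z] + [l y, z].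
Proof. by have := lbr_linear_l z 1 x y; rewrite !scale1r. Qed.

Lemma lbr0l z : [l 0, z] = 0.
Proof. by apply: (addrI [l 0, z]); rewrite -lbrDl !addr0. Qed.

Lemma lbrZl k x z : [l k *: x, z] = k *: [l x, z].
Proof. by have := lbr_linear_l z k x 0; rewrite addr0 lbr0l addr0. Qed.

Lemma lbrDr x y z : [l z, x + y] = [l z, x] + [l z, y].
Proof. exact: linearD. Qed.

Lemma lbrBl x y z : [l x - y, z] = [l x, z] - [l y, z].
Proof. by rewrite -scaleN1r lbrDl lbrZl scaleN1r. Qed.

Lemma lbrBr x y z : [l z, x - y] = [l z, x] - [l z, y].
Proof. exact: linearB. Qed.

(* The ideal I spanned by the squares, as a boolean predicate so that the
   generic subtype and quotient constructions apply. *)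
Definition leib_pred : {pred L} :=
  fun x => `[< lspan [set z | exists y, z = [l y, y]]%classic x >].

Lemma leib_pred_closed : submod_closed leib_pred.
Proof.
split=> [|k x y /asboolP Ix /asboolP Iy]; apply/asboolP; first exact: lspan0.
exact: lspanZD.
Qed.

HB.instance Definition _ := GRing.isSubmodClosed.Build K L leib_pred
  (GRing.submod_closed_semi leib_pred_closed).
HB.instance Definition _ := GRing.isOppClosed.Build L leib_pred
  (GRing.zmod_closedN (GRing.submod_closedB leib_pred_closed)).

Lemma leib_pred_sq x : [l x, x] \in leib_pred.
Proof. by apply/asboolP/lspan_mem; exists x. Qed.

Lemma lbr_leib_r x y : y \in leib_pred -> [l x, y] = 0.
Proof.
move=> /asboolP[n [c [a [Aa ->]]]]; rewrite linear_sum big1 // => i _.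
by rewrite linearZ /=; have [z ->] := Aa i; rewrite lbr_leibniz subrr scaler0.
Qed.

Lemma lbr_leib_l x y : x \in leib_pred -> [l x, y] \in leib_pred.
Proof.
move=> Ix; have -> : [l x, y] = [l x + y, x + y] - [l x, x] - [l y, y].
  rewrite lbrDl !lbrDr (lbr_leib_r y Ix) add0r.
  by rewrite addrAC addrK addrAC subrr add0r.
by rewrite !rpredB // leib_pred_sq.
Qed.

Definition leib_ker : Type := {x : L | x \in leib_pred}.
HB.instance Definition _ := SubChoice.on leib_ker.
HB.instance Definition _ := [SubChoice_isSubLmodule of leib_ker by <:].

Definition leib_quot : Type := Quotient.quot leib_pred.
HB.instance Definition _ := Choice.on leib_quot.
HB.instance Definition _ := GRing.Zmodule.on leib_quot.
HB.instance Definition _ := EqQuotient.on leib_quot.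
HB.instance Definition _ := ZmodQuotient.on leib_quot.

Definition leib_pi (x : L) : leib_quot := \pi x.

Lemma leib_piD x y : leib_pi (x + y) = leib_pi x + leib_pi y.
Proof. by rewrite /leib_pi !piE. Qed.

Lemma leib_pi_eq x y : leib_pi x = leib_pi y <-> x - y \in leib_pred.
Proof.
rewrite /leib_pi; split=> [/eqP|h]; last apply/eqP.
  by rewrite -Quotient.idealrBE.
by rewrite -Quotient.idealrBE.
Qed.

Lemma leib_reprK (x : leib_quot) : leib_pi (repr x) = x.
Proof. exact: reprK. Qed.

Lemma leib_pi_repr x : repr (leib_pi x) - x \in leib_pred.
Proof. by apply/leib_pi_eq; rewrite leib_reprK. Qed.

Definition leib_quot_scale (k : K) (x : leib_quot) : leib_quot :=
  leib_pi (k *: repr x).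

Lemma leib_piZ k x : leib_quot_scale k (leib_pi x) = leib_pi (k *: x).
Proof. by apply/leib_pi_eq; rewrite -scalerBr rpredZ // leib_pi_repr. Qed.

Lemma leib_quot_scaleA a b (x : leib_quot) :
  leib_quot_scale a (leib_quot_scale b x) = leib_quot_scale (a * b) x.
Proof. by rewrite -[x]leib_reprK !leib_piZ scalerA. Qed.

Lemma leib_quot_scale1 : left_id 1 leib_quot_scale.
Proof. by move=> x; rewrite -[x]leib_reprK leib_piZ scale1r. Qed.

Lemma leib_quot_scaleDr : right_distributive leib_quot_scale +%R.
Proof.
move=> a x y; rewrite -[x]leib_reprK -[y]leib_reprK.
by rewrite -leib_piD !leib_piZ scalerDr leib_piD.
Qed.

Lemma leib_quot_scaleDl (x : leib_quot) :
  {morph leib_quot_scale^~ x : a b / a + b >-> a + b}.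
Proof.
by move=> a b; rewrite -[x]leib_reprK !leib_piZ scalerDl leib_piD.
Qed.

HB.instance Definition _ := GRing.Zmodule_isLmodule.Build K leib_quot
  leib_quot_scaleA leib_quot_scale1 leib_quot_scaleDr leib_quot_scaleDl.

Lemma leib_pi_linear : linear leib_pi.
Proof. by move=> k x y; rewrite leib_piD -leib_piZ. Qed.
HB.instance Definition _ := GRing.isLinear.Build K L leib_quot *:%R leib_pi
  leib_pi_linear.

Definition leib_quot_lbr (x y : leib_quot) : leib_quot :=
  leib_pi [l repr x, repr y].

Lemma leib_quot_lbrE x y :
  leib_quot_lbr (leib_pi x) (leib_pi y) = leib_pi [l x, y].
Proof.
apply/leib_pi_eq; set u := repr _; set v := repr _.
have -> : [l u, v] - [l x, y] = [l u - x, v] + [l x, v - y].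
  by rewrite lbrBl lbrBr addrA subrK.
by rewrite (lbr_leib_r x (leib_pi_repr y)) addr0 lbr_leib_l // leib_pi_repr.
Qed.

Lemma leib_quot_linear_l (y : leib_quot) : linear (leib_quot_lbr^~ y).
Proof.
move=> k u v; rewrite -[u]leib_reprK -[v]leib_reprK -[y]leib_reprK.
by rewrite -linearP !leib_quot_lbrE lbrDl lbrZl linearP.
Qed.

Lemma leib_quot_linear_r (x : leib_quot) : linear (leib_quot_lbr x).
Proof.
move=> k u v; rewrite -[u]leib_reprK -[v]leib_reprK -[x]leib_reprK.
by rewrite -linearP !leib_quot_lbrE !linearP.
Qed.

Lemma leib_quot_leibniz (x y z : leib_quot) : leib_quot_lbr x (leib_quot_lbr y z) =
  leib_quot_lbr (leib_quot_lbr x y) z - leib_quot_lbr (leib_quot_lbr x z) y.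
Proof.
rewrite -[x]leib_reprK -[y]leib_reprK -[z]leib_reprK.
by rewrite !leib_quot_lbrE lbr_leibniz linearB.
Qed.

HB.instance Definition _ := isLeibniz.Build K leib_quot
  leib_quot_linear_l leib_quot_linear_r leib_quot_leibniz.

Lemma leib_piM x y : leib_pi [l x, y] = [l leib_pi x, leib_pi y].
Proof. by rewrite -leib_quot_lbrE. Qed.

Lemma leib_quot_lie (x : leib_quot) : [l x, x] = 0.
Proof.
rewrite -[x]leib_reprK -leib_piM -[RHS](linear0 leib_pi).
by apply/leib_pi_eq; rewrite subr0 leib_pred_sq.
Qed.

Definition leib_act (v : leib_ker) (x : leib_quot) : leib_ker :=
  exist _ [l val v, repr x] (lbr_leib_l (repr x) (valP v)).

Lemma leib_actE v x : val (leib_act v (leib_pi x)) = [l val v, x].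
Proof.
apply/eqP; rewrite -subr_eq0 /= -lbrBr; apply/eqP/lbr_leib_r.
exact: leib_pi_repr.
Qed.

End LeibnizKernel.

Inductive diamond_idx (m : nat) : Type :=
  | dJ | dP of 'I_m | dQ of 'I_m | dT.
Arguments dJ {m}.
Arguments dT {m}.

Section DiamondIdx.
Variable m : nat.

Definition diamond_idx_code (a : diamond_idx m) : unit + 'I_m + 'I_m + unit :=
  match a with
  | dJ => inl (inl (inl tt)) | dP k => inl (inl (inr k))
  | dQ k => inl (inr k) | dT => inr tt
  end.

Definition diamond_idx_decode (s : unit + 'I_m + 'I_m + unit) : diamond_idx m :=
  match s with
  | inl (inl (inl _)) => dJ | inl (inl (inr k)) => dP k
  | inl (inr k) => dQ k | inr _ => dT
  end.

Lemma diamond_idx_codeK : cancel diamond_idx_code diamond_idx_decode.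
Proof. by case. Qed.

HB.instance Definition _ := Finite.copy (diamond_idx m)
  (can_type diamond_idx_codeK).

Lemma big_diamond (V : nmodType) (F : diamond_idx m -> V) :
  \sum_a F a = F dJ + \sum_k F (dP k) + \sum_k F (dQ k) + F dT.
Proof.
have bij : bijective diamond_idx_decode.
  exists diamond_idx_code; last exact: diamond_idx_codeK.
  by case=> [[[[]|k]|k]|[]].
rewrite (reindex _ (onW_bij _ bij)) !big_sumType /=.
by rewrite !(big_pred1 tt) //; case.
Qed.

End DiamondIdx.

Section Diamond.
Variables (R : realType) (m : nat).
Local Notation C := R[i].
Local Notation ii := ('i%C : C).
Local Notation idx := (diamond_idx m).

(* For a family b indexed like the basis J, P_1, ..., P_m, Q_1, ..., Q_m, T
   (with k : 'I_m standing for the index k + 1), the value that the defining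
   relations of the diamond algebra prescribe for the bracket [b a, b c]. *)
Definition diamond_rel (M : lmodType C) (b : idx -> M) (a c : idx) : M :=
  match a, c with
  | dJ, dP k => ii *: b (dP k)
  | dP k, dJ => - (ii *: b (dP k))
  | dJ, dQ k => - (ii *: b (dQ k))
  | dQ k, dJ => ii *: b (dQ k)
  | dP k, dQ l => if k == l then (2 * ii) *: b dT else 0
  | dQ l, dP k => if k == l then - ((2 * ii) *: b dT) else 0
  | _, _ => 0
  end.

Section DiamondRel.
Variables (M : lmodType C) (b : idx -> M) (br : M -> M -> M).
Hypothesis brl : forall y, linear (br^~ y).
Hypothesis brr : forall x, linear (br x).
Hypothesis brE : forall a c, br (b a) (b c) = diamond_rel b a c.
Hypothesis b_ind : forall P : M -> Prop, P 0 ->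
  (forall k u v, P u -> P v -> P (k *: u + v)) ->
  (forall a, P (b a)) -> forall x, P x.

Let lD w k u v : br (k *: u + v) w = k *: br u w + br v w.
Proof. exact: brl. Qed.
Let rD w k u v : br w (k *: u + v) = k *: br w u + br w v.
Proof. exact: brr. Qed.
Let l0 w : br 0 w = 0.
Proof. by have := lD w (-1) 0 0; rewrite scaler0 addr0 scaleN1r addNr. Qed.
Let r0 w : br w 0 = 0.
Proof. by have := rD w (-1) 0 0; rewrite scaler0 addr0 scaleN1r addNr. Qed.
Let lZ w k u : br (k *: u) w = k *: br u w.
Proof. by rewrite -[k *: u]addr0 lD l0 addr0. Qed.
Let rZ w k u : br w (k *: u) = k *: br w u.
Proof. by rewrite -[k *: u]addr0 rD r0 addr0. Qed.
Let lN w u : br (- u) w = - br u w.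
Proof. by rewrite -scaleN1r lZ scaleN1r. Qed.
Let rN w u : br w (- u) = - br w u.
Proof. by rewrite -scaleN1r rZ scaleN1r. Qed.

Lemma diamond_rel_leibniz x y z : br x (br y z) = br (br x y) z - br (br x z) y.
Proof.
have comb k (u v w t : M) : k *: (u - v) + (w - t) = (k *: u + w) - (k *: v + t).
  by rewrite scalerBr opprD addrACA.
elim/b_ind: x => [|k u v IHu IHv|a]; first by rewrite !l0 subrr.
  by rewrite !lD IHu IHv comb.
elim/b_ind: y => [|k u v IHu IHv|c]; first by rewrite !(l0, r0) subrr.
  by rewrite !(lD, rD) IHu IHv comb.
elim/b_ind: z => [|k u v IHu IHv|d]; first by rewrite !(l0, r0) subrr.
  by rewrite !(lD, rD) IHu IHv comb.
case: a => [|i|i|]; case: c => [|j|j|]; case: d => [|l|l|];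
  rewrite !brE /= ?(l0, r0, lZ, rZ, lN, rN) ?brE /=;
  do ?[case: (_ == _)] => //=;
  rewrite ?(l0, r0, lZ, rZ, lN, rN) ?brE /=;
  rewrite ?(scaler0, subr0, sub0r, oppr0, scalerN, opprK, subrr) //;
  by rewrite ?(add0r, addr0, addNr, addrN, subrr, oppr0).
Qed.

Lemma diamond_rel_anti x y : br x y = - br y x.
Proof.
elim/b_ind: x => [|k u v IHu IHv|a]; first by rewrite l0 r0 oppr0.
  by rewrite lD rD IHu IHv scalerN opprD.
elim/b_ind: y => [|k u v IHu IHv|c]; first by rewrite l0 r0 oppr0.
  by rewrite lD rD IHu IHv scalerN opprD.
rewrite !brE; case: a => [|i|i|]; case: c => [|j|j|] //=; rewrite ?oppr0 ?opprK //.
  by case: eqP => _; rewrite ?opprK ?oppr0.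
by case: eqP => _; rewrite ?oppr0.
Qed.

End DiamondRel.

Definition diamond : Type := {ffun idx -> C^o}.
HB.instance Definition _ := GRing.Lmodule.on diamond.

Definition diamond_basis (a : idx) : diamond := [ffun c => (c == a)%:R].

Definition diamond_lbr (x y : diamond) : diamond :=
  \sum_a \sum_c (x a * y c) *: diamond_rel diamond_basis a c.

Lemma diamond_linear_l y : linear (diamond_lbr^~ y).
Proof.
move=> k u v; rewrite /diamond_lbr scaler_sumr -big_split; apply: eq_bigr => a _.
rewrite scaler_sumr -big_split; apply: eq_bigr => c _ /=.
by rewrite !ffunE mulrDl scalerDl scalerA mulrA.
Qed.

Lemma diamond_linear_r x : linear (diamond_lbr x).
Proof.
move=> k u v; rewrite /diamond_lbr scaler_sumr -big_split; apply: eq_bigr => a _.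
rewrite scaler_sumr -big_split; apply: eq_bigr => c _ /=.
by rewrite !ffunE mulrDr scalerDl scalerA mulrCA.
Qed.

Lemma diamond_lbr_basis a c :
  diamond_lbr (diamond_basis a) (diamond_basis c) = diamond_rel diamond_basis a c.
Proof.
rewrite /diamond_lbr (bigD1 a) //= (bigD1 c) //= !ffunE !eqxx mul1r scale1r.
rewrite big1 ?addr0 => [|d /negPf dc]; last by rewrite !ffunE dc mulr0 scale0r.
rewrite big1 ?addr0 // => d /negPf da; rewrite big1 // => e _.
by rewrite !ffunE da mul0r scale0r.
Qed.

Lemma diamond_ind_basis (P : diamond -> Prop) :
  P 0 -> (forall k u v, P u -> P v -> P (k *: u + v)) ->
  (forall a, P (diamond_basis a)) -> forall x, P x.
Proof.
move=> P0 PD Pb x.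
have -> : x = \sum_a x a *: diamond_basis a.
  apply/ffunP => c; rewrite sum_ffunE (bigD1 c) //= !ffunE eqxx big1 => [|d].
    by rewrite addr0 /GRing.scale /= mulr1.
  by rewrite !ffunE eq_sym => /negPf ->; rewrite scaler0.
by apply: big_rec => // a u _ Pu; apply: PD.
Qed.

Lemma diamond_leibniz x y z : diamond_lbr x (diamond_lbr y z) =
  diamond_lbr (diamond_lbr x y) z - diamond_lbr (diamond_lbr x z) y.
Proof.
exact: diamond_rel_leibniz diamond_linear_l diamond_linear_r diamond_lbr_basis
  diamond_ind_basis x y z.
Qed.

HB.instance Definition _ := isLeibniz.Build C diamond
  diamond_linear_l diamond_linear_r diamond_leibniz.

Lemma diamond_lie (x : diamond) : [l x, x] = 0.
Proof.
have /eqP := diamond_rel_anti diamond_linear_l diamond_linear_r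
  diamond_lbr_basis diamond_ind_basis x x.
rewrite -subr_eq0 opprK -mulr2n -scaler_nat scaler_eq0 pnatr_eq0 /=.
by move/eqP.
Qed.

(* With j : 'I_m.+2 standing for the index j + 1, X_1 is X ord0, X_{m+2} is
   X ord_max and, for the index k + 1 encoded by k : 'I_m, X_{m+2-(k+1)} is
   X (inord (m - k)).  The value is the one prescribed for (X_{j+1}, a). *)
Definition diamond_mod_rel (M : lmodType C) (X : 'I_m.+2 -> M)
    (j : 'I_m.+2) (a : idx) : M :=
  match a with
  | dJ => if (j == ord0) || (j == ord_max)
          then (ii * m%:R / m.+2%:R) *: X j else - (2 * ii / m.+2%:R) *: X j
  | dP k => if j == ord0 then X (inord (m - k)) else 0
  | dQ k => if j == inord (m - k) then X ord_max else 0
  | dT => if j == ord0 then - (ii / 2) *: X ord_max else 0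
  end.

Definition diamond_mod : Type := {ffun 'I_m.+2 -> C^o}.
HB.instance Definition _ := GRing.Lmodule.on diamond_mod.

Definition diamond_mod_basis (j : 'I_m.+2) : diamond_mod :=
  [ffun l => (l == j)%:R].

Definition diamond_act (v : diamond_mod) (x : diamond) : diamond_mod :=
  \sum_j \sum_a (v j * x a) *: diamond_mod_rel diamond_mod_basis j a.

Lemma diamond_act_linear_l x : linear (diamond_act^~ x).
Proof.
move=> k u v; rewrite /diamond_act scaler_sumr -big_split; apply: eq_bigr => j _.
rewrite scaler_sumr -big_split; apply: eq_bigr => a _ /=.
by rewrite !ffunE mulrDl scalerDl scalerA mulrA.
Qed.

Lemma diamond_act_linear_r v : linear (diamond_act v).
Proof.
move=> k x y; rewrite /diamond_act scaler_sumr -big_split; apply: eq_bigr => j _.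
rewrite scaler_sumr -big_split; apply: eq_bigr => a _ /=.
by rewrite !ffunE mulrDr scalerDl scalerA mulrCA.
Qed.

Lemma diamond_act_basis j a :
  diamond_act (diamond_mod_basis j) (diamond_basis a) =
  diamond_mod_rel diamond_mod_basis j a.
Proof.
rewrite /diamond_act (bigD1 j) //= (bigD1 a) //= !ffunE !eqxx mul1r scale1r.
rewrite big1 ?addr0 => [|d /negPf da]; last by rewrite !ffunE da mulr0 scale0r.
rewrite big1 ?addr0 // => d /negPf dj; rewrite big1 // => e _.
by rewrite !ffunE dj mul0r scale0r.
Qed.

Lemma diamond_mod_ind_basis (P : diamond_mod -> Prop) :
  P 0 -> (forall k u v, P u -> P v -> P (k *: u + v)) ->
  (forall j, P (diamond_mod_basis j)) -> forall v, P v.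
Proof.
move=> P0 PD Pb v.
have -> : v = \sum_j v j *: diamond_mod_basis j.
  apply/ffunP => l; rewrite sum_ffunE (bigD1 l) //= !ffunE eqxx big1 => [|d].
    by rewrite addr0 /GRing.scale /= mulr1.
  by rewrite !ffunE eq_sym => /negPf ->; rewrite scaler0.
by apply: big_rec => // j u _ Pu; apply: PD.
Qed.

Section DiamondModRel.
Variables (M D : lmodType C) (X : 'I_m.+2 -> M) (b : idx -> D).
Variables (br : D -> D -> D) (act : M -> D -> M).
Hypothesis brl : forall y, linear (br^~ y).
Hypothesis brr : forall x, linear (br x).
Hypothesis brE : forall a c, br (b a) (b c) = diamond_rel b a c.
Hypothesis b_ind : forall P : D -> Prop, P 0 ->
  (forall k u v, P u -> P v -> P (k *: u + v)) ->
  (forall a, P (b a)) -> forall x, P x.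
Hypothesis actl : forall x, linear (act^~ x).
Hypothesis actr : forall v, linear (act v).
Hypothesis actE : forall j a, act (X j) (b a) = diamond_mod_rel X j a.
Hypothesis X_ind : forall P : M -> Prop, P 0 ->
  (forall k u v, P u -> P v -> P (k *: u + v)) ->
  (forall j, P (X j)) -> forall v, P v.

Let lD x k u v : act (k *: u + v) x = k *: act u x + act v x.
Proof. exact: actl. Qed.
Let rD v k x y : act v (k *: x + y) = k *: act v x + act v y.
Proof. exact: actr. Qed.
Let l0 x : act 0 x = 0.
Proof. by have := lD x (-1) 0 0; rewrite scaler0 addr0 scaleN1r addNr. Qed.
Let r0 v : act v 0 = 0.
Proof. by have := rD v (-1) 0 0; rewrite scaler0 addr0 scaleN1r addNr. Qed.
Let lZ x k u : act (k *: u) x = k *: act u x.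
Proof. by rewrite -[k *: u]addr0 lD l0 addr0. Qed.
Let rZ v k x : act v (k *: x) = k *: act v x.
Proof. by rewrite -[k *: x]addr0 rD r0 addr0. Qed.
Let rN v x : act v (- x) = - act v x.
Proof. by rewrite -scaleN1r rZ scaleN1r. Qed.
Let bD w k u v : br (k *: u + v) w = k *: br u w + br v w.
Proof. exact: brl. Qed.
Let bDr w k u v : br w (k *: u + v) = k *: br w u + br w v.
Proof. exact: brr. Qed.
Let b0 w : br 0 w = 0.
Proof. by have := bD w (-1) 0 0; rewrite scaler0 addr0 scaleN1r addNr. Qed.
Let br0 w : br w 0 = 0.
Proof. by have := bDr w (-1) 0 0; rewrite scaler0 addr0 scaleN1r addNr. Qed.

Lemma diamond_mod_relP v x y : act v (br x y) = act (act v x) y - act (act v y) x.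
Proof.
have comb k (u w s t : M) : k *: (u - w) + (s - t) = (k *: u + s) - (k *: w + t).
  by rewrite scalerBr opprD addrACA.
elim/X_ind: v => [|k u w IHu IHw|j]; first by rewrite !l0 subrr.
  by rewrite !lD IHu IHw comb.
elim/b_ind: x => [|k u w IHu IHw|a]; first by rewrite b0 !r0 l0 subrr.
  by rewrite bD !(lD, rD) IHu IHw comb.
elim/b_ind: y => [|k u w IHu IHw|c]; first by rewrite br0 !r0 l0 subrr.
  by rewrite bDr !(lD, rD) IHu IHw comb.
have mk (k : 'I_m) : (m - k < m.+2)%N by rewrite ltnS leqW ?leq_subr.
have n0 (k : 'I_m) : (inord (m - k) == ord0 :> 'I_m.+2) = false.
  by rewrite -val_eqE /= inordK // subn_eq0 leqNgt ltn_ord.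
have nm (k : 'I_m) : (inord (m - k) == ord_max :> 'I_m.+2) = false.
  by rewrite -val_eqE /= inordK // ltn_eqF // ltnS leq_subr.
have kl (k l : 'I_m) : (inord (m - k) == inord (m - l) :> 'I_m.+2) = (k == l).
  rewrite -!val_eqE /= !inordK //; apply/eqP/eqP => [|->//].
  by move=> e; rewrite -(subKn (ltnW (ltn_ord k))) e subKn // ltnW.
have n0' (k : 'I_m) : (ord0 == inord (m - k) :> 'I_m.+2) = false.
  by rewrite eq_sym.
have nm' (k : 'I_m) : (ord_max == inord (m - k) :> 'I_m.+2) = false.
  by rewrite eq_sym.
have om : (ord_max == ord0 :> 'I_m.+2) = false by [].
have m2 : m.+2%:R != 0 :> C by rewrite pnatr_eq0.
have t2 : 2 != 0 :> C by rewrite pnatr_eq0.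
have i2 : ii * ii = -1 by rewrite -expr2 sqr_i.
have i_sum : ii * m%:R / m.+2%:R = ii - 2 * ii / m.+2%:R.
  by apply/eqP; rewrite eq_sym subr_eq -mulrDl [2 * _]mulrC -mulrDr -natrD addn2 mulfK.
have half (u : M) : (2 * ii) *: (- (ii / 2) *: u) = u.
  rewrite scalerA (_ : _ * _ = 1) ?scale1r // -[RHS]opprK -i2.
  by rewrite mulrN [ii / 2]mulrC mulrACA mulfV // mul1r.
pose E := (eqxx, n0, nm, n0', nm', om, kl).
have s0 (k : C) : k *: 0 = 0 :> M := scaler0 _ k.
have subs : (forall u : M, u - 0 = u) * (forall u : M, 0 - u = - u) *
    (- 0 = 0 :> M) * (forall u : M, u - u = 0) * (0 + 0 = 0 :> M).
  by do 4?split; [exact: subr0 | exact: sub0r | exact: oppr0 | exact: subrr |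
    exact: addr0].
have aI (f : bool) (u w : M) z :
  act (if f then u else w) z = if f then act u z else act w z by case: f.
have aIr (f : bool) (x y : D) z :
  act z (if f then x else y) = if f then act z x else act z y by case: f.
case: (eqVneq j ord0) => [->|/negPf j0];
  last case: (eqVneq j ord_max) => [->|/negPf jm].
- case: a => [|k|k|]; case: c => [|l|l|]; rewrite !brE /=
    ?(r0, l0, rZ, lZ, rN, actE) /= ?E /= ?(l0, lZ, actE) /= ?E /=
    ?(s0, subs) // ?aIr ?(rN, rZ, r0, actE) /= ?E ?(s0, subs) //.
  + by rewrite -scalerBl i_sum opprK subrK.
  + by rewrite !scalerA mulrC subrr.
  + by rewrite -scalerBl -opprD i_sum [_ + (_ - _)]addrC subrK scaleNr.
  + by rewrite half.
  + by rewrite half; case: (l == k); rewrite ?subs.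
  + by rewrite !scalerA mulrC subrr.
- case: a => [|k|k|]; case: c => [|l|l|]; rewrite !brE /=
    ?(r0, l0, rZ, lZ, rN, actE) /= ?E /= ?(l0, lZ, actE) /= ?E /=
    ?(s0, subs) // ?aIr ?(rN, rZ, r0, actE) /= ?E ?(s0, subs) // ?if_same //.
case: a => [|k|k|]; case: c => [|l|l|]; rewrite !brE /=
    ?(r0, l0, rZ, lZ, rN, actE) /= ?(E, j0, jm) /= ?aI ?(l0, lZ, actE) /=
    ?(E, j0, jm) /= ?(s0, subs) // ?aIr ?(rN, rZ, r0, actE) /= ?(E, j0, jm)
    ?(s0, subs, if_same) //.
- case: (_ == _); rewrite ?(s0, subs) //.
  by rewrite -scalerBl -opprD i_sum [_ + (_ - _)]addrC subrK scaleNr.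
- case: (_ == _); rewrite ?(s0, subs) //.
  by rewrite -scalerBl i_sum opprK subrK.
Qed.

End DiamondModRel.

Lemma diamond_actM v x y :
  diamond_act v [l x, y] =
  diamond_act (diamond_act v x) y - diamond_act (diamond_act v y) x.
Proof.
exact: (diamond_mod_relP diamond_linear_l diamond_linear_r diamond_lbr_basis
  diamond_ind_basis diamond_act_linear_l diamond_act_linear_r diamond_act_basis
  diamond_mod_ind_basis v x y).
Qed.

End Diamond.

(* Main.v *)
Require Import Defs.
From HB Require Import structures.
From mathcomp Require Import all_boot all_order all_algebra.
From mathcomp Require Import boolp classical_sets reals complex.

Set Implicit Arguments.
Unset Strict Implicit.
Unset Printing Implicit Defensive.

Import GRing.Theory Num.Theory.
Local Open Scope ring_scope.

(** Fix a lift [h] of [J] to [L].  The Leibniz identity says that right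
multiplication by [h] is a derivation of [L] ([lbr_weight]); since [L]
annihilates [I] from the left, it depends on [J] alone.  Its
weights on the quotient [L/I] are [0], [i] and [-i], integral multiples of [i],
whereas those on [I] are [i (1 - 2/(m+2))] and [- 2i/(m+2)], which are never
integral multiples of [i] because [0 < 2/(m+2) < 1] ([mod_weight_nonintegral]).

This gap between the two spectra gives the result without any computation in
the remaining generators.  First, for each basis vector [a] of the diamond
algebra, of weight [lambda], any lift of [a] fails to be an eigenvector only by
an element of [I]; right multiplication by [h] minus [lambda] is invertible on
[I], so the lift can be corrected inside [I] into an eigenvector
([weight_lift]).  Second, for corrected lifts [b a] and [b c], both the bracket
[[b a, b c]] and the combination of the [b d] that the diamond relations
prescribe for it have the weight of [a] plus the weight of [c], by the
derivation property and because the diamond relations are graded.  Their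
difference lies in [I] and has an integral weight, hence it is zero.  So the
corrected lifts satisfy the diamond relations exactly, and their span is closed
under the bracket. *)

(** * Bases, spans and diagonal endomorphisms *)

Section Bases.
Variables (K : fieldType) (M N : lmodType K) (T : finType).

Lemma is_basis_bij (f : {linear M -> N}) (b : T -> M) :
  bijective f -> is_basis b -> is_basis (fun t => f (b t)).
Proof.
move=> [g fK gK] [b_free b_gen]; split=> [c|y].
  move=> c0; apply: b_free; apply: (can_inj fK).
  by rewrite linear0 linear_sum -[RHS]c0; apply: eq_bigr => t _; rewrite linearZ.
have [c gy] := b_gen (g y); exists c.
by rewrite -[y]gK gy linear_sum; apply: eq_bigr => t _; rewrite linearZ.
Qed.

Section Diagonal.
Variables (X : T -> M) (f : {linear M -> M}) (mu : T -> K) (lam : K).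
Hypotheses (X_basis : is_basis X) (f_diag : forall t, f (X t) = mu t *: X t).
Hypothesis lam_gap : forall t, mu t != lam.

Lemma diag_shift (c : T -> K) :
  f (\sum_t c t *: X t) - lam *: (\sum_t c t *: X t) =
  \sum_t ((mu t - lam) * c t) *: X t.
Proof.
rewrite linear_sum scaler_sumr -sumrB; apply: eq_bigr => t _.
by rewrite linearZ /= f_diag !scalerA -scalerBl mulrBl [c t * _]mulrC.
Qed.

Lemma diag_shift_surj v : exists w, f w - lam *: w = v.
Proof.
have [c ->] := X_basis.2 v; exists (\sum_t ((mu t - lam)^-1 * c t) *: X t).
by rewrite diag_shift; apply: eq_bigr => t _; rewrite mulVKf ?subr_eq0.
Qed.

Lemma diag_shift_inj v : f v = lam *: v -> v = 0.
Proof.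
have [c ->] := X_basis.2 v => /eqP; rewrite -subr_eq0 diag_shift => /eqP c0.
rewrite big1 // => t _.
have /eqP := X_basis.1 _ c0 t.
by rewrite mulf_eq0 subr_eq0 (negPf (lam_gap t)) => /eqP ->; rewrite scale0r.
Qed.

End Diagonal.
End Bases.

Lemma is_basis_delta (K : fieldType) (T : finType) :
  is_basis (fun t => [ffun s => (s == t)%:R] : {ffun T -> K^o}).
Proof.
have sumE (c : T -> K) t :
    (\sum_a c a *: ([ffun s => (s == a)%:R] : {ffun T -> K^o})) t = c t.
  rewrite sum_ffunE (bigD1 t) //= !ffunE eqxx big1 => [|d].
    by rewrite addr0 /GRing.scale /= mulr1.
  by rewrite !ffunE eq_sym => /negPf ->; rewrite scaler0.
split=> [c c0 t|x]; first by rewrite -sumE c0 ffunE.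
by exists x; apply/ffunP => t; rewrite sumE.
Qed.

(** * Right multiplication in a Leibniz algebra *)

Section LeibnizLemmas.
Variables (K : fieldType) (L : leibnizType K).

(** This is the Leibniz identity, read as saying that right multiplication by
    [h] is a derivation. *)
Lemma lbr_weight (h x y : L) (a c : K) :
  [l x, h] = a *: x -> [l y, h] = c *: y ->
  [l [l x, y], h] = (a + c) *: [l x, y].
Proof.
move=> xh yh; have := lbr_leibniz x y h.
rewrite yh linearZ /= xh lbrZl => /eqP; rewrite eq_sym subr_eq => /eqP ->.
by rewrite -scalerDl addrC.
Qed.

Lemma lspan_lbr (T : finType) (b : T -> L) :
    (forall s t, lspan (range b) [l b s, b t]) ->
  forall x y, lspan (range b) x -> lspan (range b) y -> lspan (range b) [l x, y].
Proof.
move=> b_lbr x y [n [c [u [bu ->]]]] [p [d [v [bv ->]]]].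
have span_sum k (e : 'I_k -> K) (w : 'I_k -> L) :
    (forall i, lspan (range b) (w i)) -> lspan (range b) (\sum_i e i *: w i).
  move=> bw; apply: big_rec => [|i z _]; first exact: lspan0.
  exact: lspanZD.
have -> : [l \sum_i c i *: u i, \sum_j d j *: v j] =
          \sum_i c i *: [l u i, \sum_j d j *: v j].
  elim/big_rec2: _ => [|i z1 z2 _ IH]; first exact: lbr0l.
  by rewrite lbrDl lbrZl IH.
apply: (span_sum) => i; rewrite linear_sum /=.
under eq_bigr do rewrite linearZ /=.
apply: span_sum => j.
by have [[s _ <-] [t _ <-]] := (bu i, bv j).
Qed.

Lemma leib_pi_eq0 (x : L) : leib_pi x = 0 <-> x \in leib_pred (L := L).
Proof. by rewrite -(linear0 (@leib_pi K L)) leib_pi_eq subr0. Qed.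

Lemma leib_pi_val (v : leib_ker L) : leib_pi (val v) = 0.
Proof. exact/leib_pi_eq0/(valP v). Qed.

Lemma leib_kerP (x : L) :
  x \in leib_pred (L := L) -> exists v : leib_ker L, val v = x.
Proof. by move=> Ix; exists (Sub x Ix); rewrite SubK. Qed.

Lemma is_basis_extension (S T : finType) (b : S -> L) (X : T -> leib_ker L) :
    is_basis (fun s => leib_pi (b s)) -> is_basis X ->
  is_basis (fun s : S + T => match s with inl a => b a | inr j => val (X j) end).
Proof.
move=> [b_free b_gen] [X_free X_gen].
have val_sum (c : T -> K) : val (\sum_j c j *: X j) = \sum_j c j *: val (X j).
  by rewrite linear_sum; apply: eq_bigr => j _; rewrite linearZ.
have pi_sum (c : S -> K) :
    leib_pi (\sum_s c s *: b s) = \sum_s c s *: leib_pi (b s).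
  by rewrite linear_sum; apply: eq_bigr => j _; rewrite linearZ.
split=> [c|x]; rewrite ?big_sumType /=.
  move=> c0; have cl s : c (inl s) = 0.
    apply: (b_free (fun s => c (inl s))); rewrite -pi_sum.
    by rewrite -[LHS]addr0 -[X in _ + X](leib_pi_val (\sum_j c (inr j) *: X j))
      -leib_piD val_sum c0 linear0.
  case=> [//|j]; apply: (X_free (fun j => c (inr j))); apply: val_inj.
  rewrite val_sum linear0 -[RHS]c0 [X in _ = X + _]big1 ?add0r // => s _.
  by rewrite cl scale0r.
have [c xc] := b_gen (leib_pi x).
have [|r rE] := @leib_kerP (x - \sum_s c s *: b s).
  by apply/leib_pi_eq; rewrite pi_sum.
have [d rd] := X_gen r.
exists (fun s => match s with inl a => c a | inr j => d j end).
by rewrite big_sumType /= -val_sum -rd rE addrC subrK.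
Qed.

Section RightAction.
Variables (h : L) (T : finType) (X : T -> leib_ker L) (mu : T -> K) (lam : K).
Hypothesis X_basis : is_basis X.
Hypothesis X_weight : forall t, leib_act (X t) (leib_pi h) = mu t *: X t.
Hypothesis lam_gap : forall t, mu t != lam.

Fact leib_act_linear_l (x : leib_quot L) : linear ((@leib_act K L)^~ x).
Proof.
move=> k u v; apply: val_inj; rewrite linearP /=.
by rewrite lbrDl lbrZl.
Qed.

Let act_h : {linear leib_ker L -> leib_ker L} :=
  HB.pack ((@leib_act K L)^~ (leib_pi h))
    (GRing.isLinear.Build K _ _ *:%R _ (leib_act_linear_l (leib_pi h))).

Lemma weight_leib_eq0 (x : L) :
  x \in leib_pred (L := L) -> [l x, h] = lam *: x -> x = 0.
Proof.
move=> /leib_kerP[v <-] vh; suff -> : v = 0 by [].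
apply: (diag_shift_inj (f := act_h) X_basis X_weight lam_gap).
by apply: val_inj; rewrite leib_actE linearZ.
Qed.

(** Any lift of [x] misses the eigenvector equation by an element of [I]; as
    right multiplication by [h] minus [lam] maps [I] onto itself, moving the lift
    inside [I] cancels this defect. *)
Lemma weight_lift (x : leib_quot L) :
  [l x, leib_pi h] = lam *: x -> exists2 y, leib_pi y = x & [l y, h] = lam *: y.
Proof.
move=> xh; pose z := repr x.
have [|v vE] := @leib_kerP (lam *: z - [l z, h]).
  by apply/leib_pi_eq; rewrite linearZ /= leib_piM leib_reprK.
have [w] := diag_shift_surj (f := act_h) X_basis X_weight lam_gap v.
move=> fw; have wE : [l val w, h] - lam *: val w = lam *: z - [l z, h].
  by rewrite -vE -fw linearB linearZ -leib_actE.
exists (z + val w).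
  by rewrite leib_piD leib_pi_val addr0 leib_reprK.
by apply/eqP; rewrite lbrDl scalerDr -subr_eq0 opprD addrACA wE addrC subrKA subrr.
Qed.

End RightAction.
End LeibnizLemmas.

(** * Weights of the diamond algebra and of its module *)

Section Weights.
Variables (R : realType) (m : nat).
Local Notation C := R[i].
Local Notation ii := ('i%C : C).

Lemma diamond_basis_is_basis : is_basis (@diamond_basis R m).
Proof. exact: is_basis_delta. Qed.

Lemma diamond_mod_basis_is_basis : is_basis (@diamond_mod_basis R m).
Proof. exact: is_basis_delta. Qed.

Lemma linear_diamond_rel (M N : lmodType C) (f : {linear M -> N})
    (b : diamond_idx m -> M) a c :
  f (diamond_rel b a c) = diamond_rel (fun d => f (b d)) a c.
Proof.
by case: a => [|k|k|]; case: c => [|l|l|] /=; try case: (_ == _);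
  rewrite ?linear0 ?linearN ?linearZ.
Qed.

Lemma linear_diamond_mod_rel (M N : lmodType C) (f : {linear M -> N})
    (X : 'I_m.+2 -> M) j a :
  f (diamond_mod_rel X j a) = diamond_mod_rel (fun l => f (X l)) j a.
Proof.
by case: a => [|k|k|] /=; case: ifP => _; rewrite ?linear0 ?linearZ.
Qed.

(** Weights for the right multiplication by [J], in units of [i]; the sign for
    [P_k] is the one of [[P_k, J] = - i P_k]. *)
Definition diamond_weight (a : diamond_idx m) : int :=
  match a with dP _ => -1 | dQ _ => 1 | _ => 0 end.

Definition mod_weight (j : 'I_m.+2) : C :=
  if (j == ord0) || (j == ord_max)
  then ii * m%:R / m.+2%:R else - (2 * ii / m.+2%:R).

Lemma diamond_relJ (M : lmodType C) (b : diamond_idx m -> M) a :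
  diamond_rel b a dJ = (ii * (diamond_weight a)%:~R) *: b a.
Proof.
case: a => [|k|k|] /=.
- by rewrite mulr0 scale0r.
- by rewrite mulrN1 scaleNr.
- by rewrite mulr1.
- by rewrite mulr0 scale0r.
Qed.

(** This is what makes the right-hand side of a lifted relation comparable with
    the bracket itself: each relation expresses a bracket by a multiple of a basis vector whose
    weight is the sum of the weights of its two entries. *)
Lemma diamond_rel_weight (L : leibnizType C) (b : diamond_idx m -> L) h :
    (forall a, [l b a, h] = (ii * (diamond_weight a)%:~R) *: b a) ->
  forall a c, [l diamond_rel b a c, h] =
    (ii * (diamond_weight a + diamond_weight c)%:~R) *: diamond_rel b a c.
Proof.
have lN x y : [l - x, y] = - [l x, y] :> L.
  by rewrite -scaleN1r lbrZl scaleN1r.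
move=> bh a c.
have scaleC (k l : C) (x : L) : k *: (l *: x) = l *: (k *: x).
  by rewrite !scalerA mulrC.
case: a => [|k|k|]; case: c => [|l|l|] /=; try case: (_ == _);
  by rewrite ?lN ?lbrZl ?lbr0l ?bh /= ?scaler0 ?addr0 ?add0r ?subrr ?addNr
             ?mulr0 ?scale0r ?scaler0 ?oppr0 // ?scalerN scaleC.
Qed.

(** Both values are congruent to [- 2i/(m+2)] modulo [i] times the integers, and
    [m+2] does not divide [2]. *)
Lemma mod_weight_nonintegral (m_gt0 : (0 < m)%N) j (k : int) :
  mod_weight j != ii * k%:~R.
Proof.
have m2 : m.+2%:R != 0 :> C by rewrite pnatr_eq0.
have i0 : ii != 0 by rewrite -sqrf_eq0 sqr_i oppr_eq0 oner_eq0.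
have nondiv (l : int) : 2%:R != l%:~R * m.+2%:R :> C.
  rewrite !pmulrn -intrM eqr_int; apply/eqP => e.
  have: (m.+2 %| 2)%N by rewrite -[2%N]/`|2%:Z|%N e abszM dvdn_mull.
  by move/dvdn_leq => /(_ isT); rewrite leqNgt !ltnS m_gt0.
apply/eqP; rewrite /mod_weight; case: ifP => _.
  rewrite -mulrA => /(mulfI i0) /(canRL (mulfVK m2)) e.
  have /eqP[] := nondiv (1 - k).
  by rewrite rmorphB /= mulrBl -e mul1r -(addn2 m) natrD addrC addKr.
rewrite -mulrA mulrCA -mulrN => /(mulfI i0) e.
have /eqP[] := nondiv (- k).
by rewrite rmorphN /= -e opprK mulfVK.
Qed.

End Weights.

Theorem theorem1 (R : realType) (m : nat) (L : leibnizType R[i])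
    (phi : {linear diamond R m -> leib_quot L})
    (psi : {linear diamond_mod R m -> leib_ker L})
    (m_gt0 : (0 < m)%N)
    (phi_bij : bijective phi)
    (phi_lbr : forall x y : diamond R m, phi [l x, y] = [l phi x, phi y])
    (psi_bij : bijective psi)
    (psi_act : forall (v : diamond_mod R m) (x : diamond R m),
       psi (diamond_act v x) = leib_act (psi v) (phi x)) :
  exists (b : diamond_idx m -> L) (X : 'I_m.+2 -> leib_ker L),
    [/\ is_basis (fun s : diamond_idx m + 'I_m.+2 =>
          match s with inl a => b a | inr j => val (X j) end),
        is_basis X /\
          (forall (j : 'I_m.+2) (a : diamond_idx m),
             leib_act (X j) (leib_pi (b a)) = diamond_mod_rel X j a),
        is_basis (fun a => leib_pi (b a)) /\
          (forall a c : diamond_idx m,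
             [l leib_pi (b a), leib_pi (b c)] =
               diamond_rel (fun d => leib_pi (b d)) a c) &
        forall x y : L, lspan (range b) x -> lspan (range b) y ->
          lspan (range b) [l x, y]].
Proof.
pose ii : R[i] := 'i%C.
pose X j := psi (diamond_mod_basis R j).
pose e a := phi (diamond_basis R a).
pose h := repr (e dJ).
have e_rel a c : [l e a, e c] = diamond_rel e a c.
  by rewrite -phi_lbr -linear_diamond_rel -diamond_lbr_basis.
have X_rel j a : leib_act (X j) (e a) = diamond_mod_rel X j a.
  by rewrite -psi_act diamond_act_basis linear_diamond_mod_rel.
have X_basis : is_basis X.
  exact: is_basis_bij psi_bij (diamond_mod_basis_is_basis R m).
have e_basis : is_basis e.
  exact: is_basis_bij phi_bij (diamond_basis_is_basis R m).
have X_weight j : leib_act (X j) (leib_pi h) = mod_weight R j *: X j.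
  by rewrite leib_reprK X_rel /mod_weight /=; case: ifP.
have gap (k : int) (j : 'I_m.+2) : mod_weight R j != ii * k%:~R.
  exact: mod_weight_nonintegral.
have /(_ _)/cid2-/all_sig[b b_spec] a : exists2 y, leib_pi y = e a &
    [l y, h] = (ii * (diamond_weight a)%:~R) *: y.
  apply: (weight_lift X_basis X_weight (gap _)).
  by rewrite leib_reprK e_rel diamond_relJ.
have b_pi : (fun a => leib_pi (b a)) = e by apply/funext => a; case: (b_spec a).
have b_weight a : [l b a, h] = (ii * (diamond_weight a)%:~R) *: b a.
  by case: (b_spec a).
have b_rel a c : [l b a, b c] = diamond_rel b a c.
  (* The difference of the two sides is in [I], because the relation holds in
     [L/I], and it has an integral weight, which no nonzero element of [I] has. *)
  apply/eqP; rewrite -subr_eq0; apply/eqP.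
  apply: (weight_leib_eq0 X_basis X_weight
           (gap (diamond_weight a + diamond_weight c))).
    apply/leib_pi_eq; rewrite leib_piM linear_diamond_rel b_pi -e_rel.
    by have /(congr1 (fun f => (f a, f c)))[-> ->] := b_pi.
  rewrite lbrBl (diamond_rel_weight b_weight) (lbr_weight (b_weight a) (b_weight c)).
  by rewrite -mulrDr -intrD -scalerBr.
exists b, X; split.
- by apply: is_basis_extension; rewrite ?b_pi.
- split=> // j a; have /(congr1 (fun f => f a))-> := b_pi; exact: X_rel.
- split=> [|a c]; rewrite ?b_pi //.
  by rewrite -leib_piM b_rel linear_diamond_rel b_pi.
apply: lspan_lbr => a c; rewrite b_rel.
have spanZ k d : lspan (range b) (k *: b d).
  by rewrite -[_ *: _]addr0; apply: lspanZD (lspan0 _); apply: lspan_mem; exists d.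
have spanN k d : lspan (range b) (- (k *: b d)) by rewrite -scaleNr.
by case: a => [|k|k|]; case: c => [|l|l|] //=; try case: (_ == _) => //;
  exact: lspan0.
Qed.
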